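(* Let $(V,\omega)$ be a real symplectic vector space of dimension $2n$, let $\Omega\in\Lambda^n(V^* )$ and let $L\in\mathrm{E}_\Omega$. If a hyperplane $H$ of $L$ is characteristic for $\mathrm{E}_\Omega$ at $L$, then it is strongly characteristic for $\mathrm{E}_\Omega$, i.e. $H^{(1)}\subset\mathrm{E}_\Omega$.
   Context: $\mathcal{L}(V)$ is the smooth manifold of Lagrangian planes of $(V,\omega)$ ($n$-dimensional subspaces on which $\omega$ vanishes). For $\Omega\in\Lambda^n(V^* )$, $\mathrm{E}_\Omega=\{L\in\mathcal{L}(V)\mid\Omega|_L=0\}$. Near a point $L$ it is the zero set of $F(\widetilde L)=\Omega(w_1(\widetilde L),\dots,w_n(\widetilde L))$, where $w_1(\widetilde L),\dots,w_n(\widetilde L)$ is a basis of $\widetilde L$ depending smoothly on $\widetilde L$ (changing the basis multiplies $F$ by a nonvanishing function). For an isotropic subspace $U\subset V$, its prolongation is $U^{(1)}=\{\widetilde L\in\mathcal{L}(V)\mid\widetilde L\supseteq U\}$, a smooth submanifold. An isotropic subspace $U$ is characteristic for a hypersurface $\{F=0\}$ of $\mathcal{L}(V)$ at a point $L$ of it if $U\subset L$ and $(dF)_L|_{T_LU^{(1)}}=0$ (for $\mathrm{E}_\Omega$ the function $F$ above is used); it is strongly characteristic if $U^{(1)}$ is contained in the hypersurface. *)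

(* Defs.v *)
From HB Require Import structures.
From mathcomp Require Import all_boot all_order all_algebra sesquilinear.
From mathcomp Require Import all_classical all_reals.
From mathcomp Require Import topology normedtype derive.

Set Implicit Arguments.
Unset Strict Implicit.
Unset Printing Implicit Defensive.

Import Order.TTheory GRing.Theory Num.Theory.
Import numFieldNormedType.Exports.

Local Open Scope classical_set_scope.
Local Open Scope ring_scope.

Section AlternatingForms.
Variables (R : realType) (V : vectType R) (n : nat).

Definition tuple_update (w : n.-tuple V) (i : 'I_n) (x : V) : n.-tuple V :=
  [tuple if k == i then x else tnth w k | k < n].

Definition multilinear_form (Omega : n.-tuple V -> R) : Prop :=
  forall (w : n.-tuple V) (i : 'I_n) (a : R) (x y : V),
    Omega (tuple_update w i (a *: x + y)) =
      a * Omega (tuple_update w i x) + Omega (tuple_update w i y).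

Definition alternating_form (Omega : n.-tuple V -> R) : Prop :=
  forall (w : n.-tuple V) (i j : 'I_n),
    i != j -> tnth w i = tnth w j -> Omega w = 0.

Definition exterior_form (Omega : n.-tuple V -> R) : Prop :=
  multilinear_form Omega /\ alternating_form Omega.

Definition vanishes_on (Omega : n.-tuple V -> R) (L : {vspace V}) : Prop :=
  forall w : n.-tuple V, {subset w <= L} -> Omega w = 0.

End AlternatingForms.

Section Smoothness.
Variables (R : realType) (X : normedModType R).

(* E is meant to be a linear subspace of X and A a relatively open subset of E:
   f is C^k on A when its iterated directional derivatives of order at most k,
   in directions of E, exist and are continuous on A.  Only the values of f on
   E matter. *)
Fixpoint Ck_on (E A : set X) (k : nat) (f : X -> R^o) : Prop :=
  {within A, continuous f} /\
  (if k is k'.+1 then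
     forall v : X, E v ->
       (forall x : X, A x -> derivable f x v) /\
       Ck_on E A k' (fun x : X => 'D_v f x)
   else True).

Definition smooth_on (E A : set X) (f : X -> R^o) : Prop :=
  forall k : nat, Ck_on E A k f.

End Smoothness.

Section LagrangianPlanes.
Variables (R : realType) (V : vectType R) (n : nat).
Variable omega : {skew_symmetric V}.

Definition isotropic (U : {vspace V}) : Prop := (U <= orthov omega U)%VS.

Definition lagrangian_grassmannian : set {vspace V} :=
  [set L | isotropic L /\ \dim L = n].

Definition prolongation (U : {vspace V}) : set {vspace V} :=
  [set L | lagrangian_grassmannian L /\ (U <= L)%VS].

Definition E_ (Omega : n.-tuple V -> R) : set {vspace V} :=
  [set L | lagrangian_grassmannian L /\ vanishes_on Omega L].

Definition strongly_characteristic (hypersurface : set {vspace V})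
    (U : {vspace V}) : Prop :=
  isotropic U /\ prolongation U `<=` hypersurface.

Definition symplectic_basis (e f : n.-tuple V) : Prop :=
  forall i j : 'I_n,
    [/\ omega (tnth e i) (tnth e j) = 0,
        omega (tnth f i) (tnth f j) = 0 &
        omega (tnth e i) (tnth f j) = (i == j)%:R].

(* The manifold structure of the Lagrangian Grassmannian: for a symplectic
   basis (e, f), S |-> plane e f S is a bijection from the symmetric matrices
   onto the Lagrangian planes transverse to <<f>>.  Its inverse is a chart,
   centred at the Lagrangian plane <<e>>; these charts form the smooth atlas. *)
Definition plane (e f : n.-tuple V) (S : 'M[R]_n) : {vspace V} :=
  span [tuple tnth e i + \sum_(j < n) S i j *: tnth f j | i < n].

Definition sym_mx : set 'M[R]_n := [set S | S^T = S].

(* w(L') is a basis of L' depending smoothly on the Lagrangian plane L' in a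
   neighbourhood of <<e>>.  A map into V is smooth when its composites with
   all linear forms on V are. *)
Definition smooth_frame (e f : n.-tuple V) (w : {vspace V} -> n.-tuple V) :
    Prop :=
  exists O : set 'M[R]_n,
    [/\ open O, O 0,
        forall S, (O `&` sym_mx) S -> basis_of (plane e f S) (w (plane e f S)) &
        forall (i : 'I_n) (phi : {linear V -> R^o}),
          smooth_on sym_mx (O `&` sym_mx)
            (fun S => phi (tnth (w (plane e f S)) i))].

(* Coordinates, in the chart of (e, f), of the tangent vectors at <<e>> to the
   prolongation of U: the velocities of the smooth curves lying in it. *)
Definition tangent_prolongation (e f : n.-tuple V) (U : {vspace V}) :
    set 'M[R]_n :=
  [set dS | exists (I : set R^o) (c : R^o -> 'M[R]_n),
    [/\ open I, I 0, c 0 = 0 &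
    [/\ forall t, I t -> sym_mx (c t) /\ prolongation U (plane e f (c t)),
        forall i j : 'I_n, smooth_on [set: R^o] I (fun t => c t i j) &
        is_derive (0 : R^o) (1 : R^o) c dS]]].

(* Value of the differential at <<e>> of the function F on the Lagrangian
   Grassmannian at the tangent vector with coordinates dS. *)
Definition differential_at (e f : n.-tuple V) (F : {vspace V} -> R)
    (dS : 'M[R]_n) : R :=
  'D_dS (fun S => F (plane e f S) : R^o) 0.

(* The choice of the chart centred at L and of the smooth frame w is
   immaterial: another frame multiplies F by a nonvanishing function. *)
Definition characteristic (Omega : n.-tuple V -> R) (L U : {vspace V}) : Prop :=
  [/\ isotropic U, (U <= L)%VS &
      exists (e f : n.-tuple V) (w : {vspace V} -> n.-tuple V),
        [/\ symplectic_basis e f, <<e>>%VS = L, smooth_frame e f w &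
            forall dS, tangent_prolongation e f U dS ->
              differential_at e f (fun L' => Omega (w L')) dS = 0]].

End LagrangianPlanes.

(* Main.v *)
Require Import Defs.
From mathcomp Require Import all_boot all_order all_algebra sesquilinear.
From mathcomp Require Import all_classical all_reals.
From HB Require Import structures.
From mathcomp Require Import fingroup perm topology normedtype derive.

Set Implicit Arguments.
Unset Strict Implicit.
Unset Printing Implicit Defensive.

Import Order.TTheory GRing.Theory Num.Theory.
Import numFieldNormedType.Exports.

Local Open Scope ring_scope.
Local Open Scope classical_set_scope.

(** Write [L = H + <u>] and let [b] be a basis of [H].  The Lagrangian
    complement [<<f>>] of [L] contains a vector [v] that is orthogonal to [H] and
    has [omega u v = 1].  The planes [L_t = <<u + t v :: b>>] are Lagrangian, contain
    [H] and pass through [L] at [t = 0]; in the chart they form the line of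
    rank one symmetric matrices [t a a^T], where [a] is the linear form on [L]
    with kernel [H] and value 1 at [u] ([plane_rank1]).  So [a a^T] is tangent to
    the prolongation of [H].

    Since [Omega] vanishes on [L], multilinearity gives
    [Omega (u + t v :: b) = t * Omega (v :: b)], and passing to the smooth frame
    [w] multiplies this by a determinant that is continuous in [t] and nonzero
    at [t = 0] ([exterior_form_change], [cvg_det], [det_dual_neq0]).  The derivative
    of [F] along the line is thus a nonzero multiple of [Omega (v :: b)]
    ([differential_at_frame]), and [H] being characteristic forces
    [Omega (v :: b) = 0].

    A Lagrangian plane containing [H] is [<<u' :: b>>] with [u'] orthogonal to
    [H].  For [c = omega u u'], the vector [u' - c v] is orthogonal to all of
    [L], hence lies in [L].  Therefore
    [Omega (u' :: b) = Omega (u' - c v :: b) + c * Omega (v :: b)] is a sum of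
    two zeros. *)

(** * Exterior forms and determinants *)
Section ExteriorForms.
Variables (R : realType) (V : vectType R) (n : nat).
Implicit Types (w x : n.-tuple V) (Omega : n.-tuple V -> R).

Lemma tuple_updateE w i y k :
  tnth (tuple_update w i y) k = if k == i then y else tnth w k.
Proof. by rewrite tnth_mktuple. Qed.

Lemma tuple_update_id w i : tuple_update w i (tnth w i) = w.
Proof. by apply/eq_from_tnth => k; rewrite tuple_updateE; case: eqP => [->|]. Qed.

Lemma multilinear_formD Omega w i y z : multilinear_form Omega ->
  Omega (tuple_update w i (y + z)) =
  Omega (tuple_update w i y) + Omega (tuple_update w i z).
Proof. by move=> Om; rewrite -[y in LHS]scale1r Om mul1r. Qed.

Lemma multilinear_form_sum Omega w i m (a : 'I_m -> R) (y : 'I_m -> V) :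
    multilinear_form Omega ->
  Omega (tuple_update w i (\sum_k a k *: y k)) =
  \sum_k a k * Omega (tuple_update w i (y k)).
Proof.
move=> Om; elim/big_rec2: _ => [|k s v _ <-]; last by rewrite Om.
have := Om w i (-1) 0 0; rewrite scaler0 addr0 mulN1r => /eqP.
by rewrite eq_sym -subr_eq0 addrK oppr_eq0 => /eqP.
Qed.

(** Expanding the value on a tuple with [w i + w j] in both slots [i] and [j]. *)
Lemma exterior_form_tperm Omega w i j : exterior_form Omega -> i != j ->
  Omega [tuple tnth w (tperm i j k) | k < n] = - Omega w.
Proof.
move=> [Om Oa] nij; pose u y z := tuple_update (tuple_update w i y) j z.
have nji : j != i by rewrite eq_sym.
have uii y : Omega (u y y) = 0.
  by apply: (Oa _ i j nij); rewrite !tuple_updateE !eqxx (negPf nij).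
have uC y z : u y z = tuple_update (tuple_update w j z) i y.
  apply/eq_from_tnth => k; rewrite !tuple_updateE.
  by case: (eqVneq k j) => // ->; rewrite (negPf nji).
have := uii (tnth w i + tnth w j).
rewrite {1}/u multilinear_formD // -!/(u _ _) !uC !multilinear_formD // -!uC.
rewrite !uii add0r addr0 => /eqP; rewrite addr_eq0 => /eqP.
have -> : u (tnth w i) (tnth w j) = w.
  apply/eq_from_tnth => k; rewrite !tuple_updateE.
  by case: (eqVneq k j) => [->|_] //; case: eqVneq => [->|].
have <- : u (tnth w j) (tnth w i) = [tuple tnth w (tperm i j k) | k < n].
  apply/eq_from_tnth => k; rewrite !tuple_updateE tnth_mktuple.
  by case: tpermP => [->|->|/eqP/negPf-> /eqP/negPf->]; rewrite ?eqxx ?(negPf nij).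
by move=> ->.
Qed.

Lemma exterior_form_perm_eq0 Omega w (s : 'S_n) : exterior_form Omega ->
  Omega w = 0 -> Omega [tuple tnth w (s k) | k < n] = 0.
Proof.
move=> Oe; have [ts -> _] := prod_tpermP s.
elim: ts w => [|[i j] ts IH] w w0.
  rewrite big_nil -[RHS]w0; congr Omega; apply/eq_from_tnth => k.
  by rewrite tnth_mktuple perm1.
rewrite big_cons; have [->|nij] := eqVneq i j; first by rewrite /= tperm1 mul1g IH.
set p := (\prod_(t <- ts) _)%g.
have -> : [tuple tnth w ((tperm i j * p)%g k) | k < n] =
    [tuple tnth [tuple tnth w (p l) | l < n] (tperm i j k) | k < n].
  by apply/eq_from_tnth => k; rewrite !tnth_mktuple permM.
by rewrite exterior_form_tperm // IH // oppr0.
Qed.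

(** Expanding each argument along [x] leaves the values on the tuples with
    entries in [x]: a repetition kills them, and without one the tuple is a
    permutation of [x]. *)
Lemma exterior_form_span_eq0 Omega x : exterior_form Omega -> Omega x = 0 ->
  vanishes_on Omega <<x>>.
Proof.
move=> Oe x0 w wx.
(* Induction on the slots not yet expanded, listed in [s]. *)
suff H (s : seq 'I_n) w' : {subset w' <= <<x>>%VS} ->
    (forall i, i \notin s -> exists k, tnth w' i = tnth x k) -> Omega w' = 0.
  by apply: (H (enum 'I_n)) => // i; rewrite mem_enum.
elim: s w' {w wx} => [|i s IH] w wx ws.
  have /boolp.choice[f fE] : forall i, exists k, tnth w i = tnth x k.
    by move=> i; exact: ws.
  have [/injectiveP finj|/injectivePn[i [j nij fij]]] := boolP (injectiveb f); last first.
    by apply: (Oe.2 _ i j nij); rewrite !fE fij.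
  rewrite -(exterior_form_perm_eq0 (perm finj) Oe x0); congr Omega.
  by apply/eq_from_tnth => k; rewrite tnth_mktuple permE fE.
rewrite -(tuple_update_id w i) (coord_span (wx _ (mem_tnth i w))).
rewrite (multilinear_form_sum _ _ _ _ Oe.1) big1 // => k _.
rewrite IH ?mulr0 // => [_ /tnthP[j ->]|j js]; rewrite tuple_updateE.
  by case: eqP => _; [apply: memv_span; rewrite mem_nth ?size_tuple|exact/wx/mem_tnth].
case: eqVneq => [_|nji]; first by exists k; rewrite (tnth_nth 0).
by apply: ws; rewrite inE negb_or nji.
Qed.

Lemma exterior_form_det (beta : 'I_n -> {linear V -> R^o}) (c : R) :
  exterior_form (fun w => \det (\matrix_(i, j) (beta j (tnth w i) : R)) * c).
Proof.
split=> [w i a y z|w i j nij wij]; last first.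
  by rewrite (determinant_alternate nij) ?mul0r // => k; rewrite !mxE wij.
rewrite mulrA -mulrDl; congr (_ * c).
rewrite -[X in _ = _ + X]mul1r; apply: (determinant_multilinear (i0 := i)).
- by apply/rowP => j; rewrite !mxE !tuple_updateE eqxx linearP mul1r.
- by apply/matrixP => k j; rewrite !mxE !tuple_updateE eq_sym (negPf (neq_lift i k)).
- by apply/matrixP => k j; rewrite !mxE !tuple_updateE eq_sym (negPf (neq_lift i k)).
Qed.

(** Both sides are exterior forms in [w] that agree at [x]. *)
Lemma exterior_form_change Omega x (beta : 'I_n -> {linear V -> R^o}) w :
    exterior_form Omega ->
    (forall i j, beta j (tnth x i) = (i == j)%:R) -> {subset w <= <<x>>%VS} ->
  Omega w = \det (\matrix_(i, j) (beta j (tnth w i) : R)) * Omega x.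
Proof.
move=> Oe bx wx; apply/eqP; rewrite -subr_eq0; apply/eqP.
have [Dm Da] := exterior_form_det beta (Omega x).
pose Psi u := Omega u - \det (\matrix_(i, j) (beta j (tnth u i) : R)) * Omega x.
apply: (exterior_form_span_eq0 (Omega := Psi) (x := x)) => //; last first.
  rewrite /Psi (_ : matrix_of_fun _ _ = 1%:M) ?det1 ?mul1r ?subrr //.
  by apply/matrixP => i j; rewrite !mxE bx.
split=> [u i a y z|u i j nij uij]; last by rewrite /Psi (Oe.2 _ i j) ?(Da _ i j) ?subrr.
by rewrite /Psi Oe.1 Dm mulrBr opprD addrACA.
Qed.

End ExteriorForms.

(** * Symplectic bases *)

Section SymplecticBases.
Variables (R : realType) (V : vectType R) (n : nat) (omega : {skew_symmetric V}).
Implicit Types (e f : n.-tuple V) (S : 'M[R]_n).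

(** The codomain is [R^o] to make this a linear form in the sense of the
    smoothness condition on frames. *)
Definition pairing (y : V) : V -> R^o := fun x => omega x y.

Lemma pairing_linear y : linear (pairing y).
Proof. by move=> a x z; rewrite /pairing linearPl. Qed.
HB.instance Definition _ y := GRing.isLinear.Build _ _ _ _ _ (pairing_linear y).

Lemma skewC x y : omega x y = - omega y x.
Proof. by rewrite hermC /= expr1 mulN1r. Qed.

(** Bilinearity, restated so that rewriting keeps [omega] in the shape that it
    has in [symplectic_basis]. *)
Lemma omegaDl x y z : omega (x + y) z = omega x z + omega y z.
Proof. exact: linearDl. Qed.
Lemma omegaDr x y z : omega z (x + y) = omega z x + omega z y.
Proof. exact: linearDr. Qed.
Lemma omegaNr x y : omega x (- y) = - omega x y.
Proof. exact: linearNr. Qed.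
Lemma omegaZl a x y : omega (a *: x) y = a * omega x y.
Proof. exact: linearZl_LR. Qed.
Lemma omegaZr a x y : omega x (a *: y) = a * omega x y.
Proof. exact: linearZr_LR. Qed.
Lemma omega_suml m (x : 'I_m -> V) y : omega (\sum_i x i) y = \sum_i omega (x i) y.
Proof. exact: linear_sumlz. Qed.
Lemma omega_sumr m x (y : 'I_m -> V) : omega x (\sum_i y i) = \sum_i omega x (y i).
Proof. exact: linear_sumr. Qed.

Lemma dual_free (beta : 'I_n -> {linear V -> R^o}) (x : n.-tuple V) :
  (forall i j, beta j (tnth x i) = (i == j)%:R) -> free x.
Proof.
move=> bx; apply/freeP => k k0 i; have := congr1 (beta i) k0.
rewrite linear_sum linear0 (bigD1 i) //= -tnth_nth linearZ /= bx eqxx.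
rewrite big1 ?addr0 => [|j ji]; first by rewrite /GRing.scale /= mulr1.
by rewrite -tnth_nth linearZ /= bx (negPf ji) scaler0.
Qed.

Lemma dual_coord (beta : 'I_n -> {linear V -> R^o}) (x : n.-tuple V) z :
    (forall i j, beta j (tnth x i) = (i == j)%:R) -> z \in <<x>>%VS ->
  z = \sum_k beta k z *: tnth x k.
Proof.
move=> bx /coord_span zE; rewrite {1}zE; apply: eq_bigr => i _.
rewrite {2}zE linear_sum (bigD1 i) //= -!tnth_nth linearZ /= bx eqxx.
rewrite big1 ?addr0 => [|j ji]; first by rewrite /GRing.scale /= mulr1.
by rewrite -tnth_nth linearZ /= bx (negPf ji) scaler0.
Qed.

Lemma symplectic_basis_dual e f : symplectic_basis omega e f ->
  forall i j, pairing (tnth f j) (tnth e i) = (i == j)%:R.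
Proof. by move=> ef i j; have [] := ef i j. Qed.

Lemma symplectic_basis_dualr e f : symplectic_basis omega e f ->
  forall i j, pairing (- tnth e j) (tnth f i) = (i == j)%:R.
Proof.
move=> ef i j; rewrite /pairing omegaNr -skewC eq_sym.
by have [] := ef j i.
Qed.

Lemma symplectic_basis_lagrangian e f : symplectic_basis omega e f ->
  lagrangian_grassmannian n omega <<e>>%VS.
Proof.
move=> ef; have bx := symplectic_basis_dual ef; split; last first.
  by have /eqnP -> := dual_free bx; rewrite size_tuple.
apply/orthovP => y z /(dual_coord bx)-> /(dual_coord bx)->.
rewrite omega_suml big1 // => i _; rewrite omega_sumr big1 // => j _.
by rewrite omegaZl omegaZr /=; have [-> _ _] := ef i j; rewrite !mulr0.
Qed.

(** [<<e>>] and [<<f>>] are complementary, so a vector orthogonal to [<<e>>]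
    has no component along [f]. *)
Lemma symplectic_basis_orthogonal e f z : symplectic_basis omega e f ->
  \dim {:V} = (2 * n)%N -> (forall i, omega (tnth e i) z = 0) -> z \in <<e>>%VS.
Proof.
move=> ef dV ez; have be := symplectic_basis_dual ef.
have bf := symplectic_basis_dualr ef.
have ef0 : (<<e>> :&: <<f>> = 0)%VS.
  apply/eqP; rewrite -subv0; apply/subvP => y /memv_capP[ye yf].
  rewrite memv0 (dual_coord be ye) big1 // => i _.
  rewrite (dual_coord bf yf) /= /pairing omega_suml big1 ?scale0r // => j _.
  by rewrite omegaZl /=; have [_ -> _] := ef j i; rewrite mulr0.
have : z \in (<<e>> + <<f>>)%VS.
  suff -> : (<<e>> + <<f>> = fullv)%VS by rewrite memvf.
  apply/eqP; rewrite eqEdim subvf dV dimv_disjoint_sum //.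
  have /eqnP -> := dual_free be; have /eqnP -> := dual_free bf.
  by rewrite !size_tuple mul2n addnn leqnn.
case/memv_addP => y ye [y' yf' zE]; suff -> : z = y by [].
rewrite zE (dual_coord bf yf') big1 ?addr0 // => i _.
rewrite /= /pairing omegaNr -skewC -[y'](addKr y) -zE omegaDr ez addr0.
rewrite (dual_coord be ye) -sumrN omega_sumr big1 ?scale0r // => j _.
by rewrite -scalerN omegaZr omegaNr; have [-> _ _] := ef i j; rewrite oppr0 mulr0.
Qed.

Definition graph_basis e f S : n.-tuple V :=
  [tuple tnth e i + \sum_(j < n) S i j *: tnth f j | i < n].

(** On the new vectors, [omega] takes the value [S j i - S i j] at the indices
    [i] and [j], so symmetry of [S] is exactly isotropy of its graph. *)
Lemma symplectic_basis_graph e f S : symplectic_basis omega e f -> S^T = S ->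
  symplectic_basis omega (graph_basis e f S) f.
Proof.
move=> ef Ssym.
have sumf i j : omega (\sum_(k < n) S i k *: tnth f k) (tnth f j) = 0.
  rewrite omega_suml big1 // => k _; rewrite omegaZl.
  by have [_ -> _] := ef k j; rewrite /= mulr0.
have sume i j : omega (tnth e i) (\sum_(k < n) S j k *: tnth f k) = S j i.
  rewrite omega_sumr (bigD1 i) //= omegaZr big1 => [|k ki].
    by have [_ _ ->] := ef i i; rewrite eqxx /= mulr1 addr0.
  by rewrite omegaZr; have [_ _ ->] := ef i k; rewrite eq_sym (negPf ki) mulr0.
move=> i j; split; last first.
- by rewrite tnth_mktuple omegaDl sumf addr0; have [] := ef i j.
- by have [] := ef i j.
rewrite !tnth_mktuple omegaDl !omegaDr sume.
have [-> _ _] := ef i j; rewrite skewC sume omega_sumr.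
rewrite [X in _ + (_ + X)]big1 => [|k _]; last by rewrite omegaZr sumf mulr0.
by rewrite -{1}Ssym mxE add0r addr0 subrr.
Qed.

(** For a basis [x] of [<<e>>], this is the basis of [<<f>>] that [omega] makes
    dual to [x]. *)
Definition dual_basis e f (x : n.-tuple V) : n.-tuple V :=
  [tuple \sum_(i < n) coord x k (tnth e i) *: tnth f i | k < n].

Lemma symplectic_basis_change e f (x : n.-tuple V) : symplectic_basis omega e f ->
  basis_of <<e>> x -> symplectic_basis omega x (dual_basis e f x).
Proof.
move=> ef bx i j; have be := symplectic_basis_dual ef.
have xe k : tnth x k \in <<e>>%VS by rewrite (basis_mem bx) // mem_tnth.
have [/orthovP iso _] := symplectic_basis_lagrangian ef; split.
- exact: iso.
- rewrite !tnth_mktuple omega_suml big1 // => k _; rewrite omega_sumr big1 // => l _.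
  by rewrite omegaZl omegaZr; have [_ -> _] := ef k l; rewrite /= !mulr0.
rewrite -(coord_free i j (basis_free bx)) -tnth_nth.
rewrite {2}(dual_coord be (xe i)) linear_sum tnth_mktuple omega_sumr.
by apply: eq_bigr => k _; rewrite omegaZr linearZ /= mulrC.
Qed.

End SymplecticBases.

(** * Smooth lines in the chart *)

Section Smoothness.
Variables (R : realType) (X : normedModType R).
Implicit Types (E A : set X) (k : nat).

Lemma Ck_on_cst E A k (a : R^o) : Ck_on E A k (fun=> a).
Proof.
elim: k a => [|k IH] a;
  (split; first by apply: continuous_subspaceT => x; exact: cvg_cst).
  by [].
move=> v _; split=> [x _|]; first exact: derivable_cst.
have -> : (fun x : X => 'D_v (fun=> a) x) = fun=> 0.
  by apply/funext => x; exact: derive_cst.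
exact: IH.
Qed.

(** The directional derivatives of a linear map are constant functions, so the
    recursion of [Ck_on] ends after one step. *)
Lemma smooth_on_linear E A (f : {linear X -> R^o}) : continuous f -> smooth_on E A f.
Proof.
move=> fc [|k]; (split; first exact: continuous_subspaceT) => // v _.
have df x : differentiable f x by exact: linear_differentiable.
split=> [x _|]; first exact: diff_derivable.
have -> : (fun x : X => 'D_v f x) = fun=> f v.
  by apply/funext => x; rewrite deriveE // diff_lin.
exact: Ck_on_cst.
Qed.

End Smoothness.

Lemma cvg_det (R : realType) (T : Type) (F : set_system T) n
    (M : T -> 'M[R]_n) (M0 : 'M[R]_n) : Filter F ->
  (forall i j, (M t i j : R^o) @[t --> F] --> (M0 i j : R^o)) ->
  (\det (M t) : R^o) @[t --> F] --> (\det M0 : R^o).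
Proof.
move=> FF MM0; apply: cvg_big => [|s _]; first exact: add_continuous.
apply: cvgM; first exact: cvg_cst.
by apply: cvg_big => [|i _]; [exact: mul_continuous|exact: MM0].
Qed.

Section TangentVectors.
Variables (R : realType) (V : vectType R) (n : nat) (omega : {skew_symmetric V}).
Variables (e f : n.-tuple V).
Hypothesis ef : symplectic_basis omega e f.

(** The line [t |-> t S] is itself a smooth curve in the prolongation. *)
Lemma tangent_prolongation_line (U : {vspace V}) (S : 'M[R]_n) : S^T = S ->
    (forall t, (U <= plane e f (t *: S))%VS) ->
  tangent_prolongation omega e f U S.
Proof.
move=> Ssym US; exists setT, (fun t : R^o => t *: S).
have tSsym t : (t *: S)^T = t *: S by rewrite linearZ /= Ssym.
split; [exact: openT|by []|exact: scale0r|split].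
- move=> t _; split; first exact: tSsym.
  by split; first exact/symplectic_basis_lagrangian/symplectic_basis_graph.
- move=> i j; have lin : linear (fun t : R^o => (t *: S) i j : R^o).
    by move=> a x y; rewrite !mxE mulrDl -mulrA.
  pose l : {linear R^o -> R^o} :=
    HB.pack (fun t : R^o => (t *: S) i j : R^o) (GRing.isLinear.Build _ _ _ _ _ lin).
  apply: (@smooth_on_linear _ _ _ _ l) => x /=.
  rewrite /l /= (_ : (fun t : R^o => _) = (fun t => t * S i j)).
    by apply: cvgMr_tmp; exact: cvg_id.
  by apply/funext => t; rewrite mxE.
- apply: DeriveDef; first exact: diff_derivable.
  by rewrite deriveE // diff_val scale1r.
Qed.

(** With [a i = coord x k (e i)] and [g] the dual basis of [x], the generator
    [e i + t a i (sum_j a j f j)] of the left-hand side is [e i + t a i g k], the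
    image of [e i] under the map that moves [x k] by [t g k] and fixes the other
    [x j]. *)
Lemma plane_rank1 (x : n.-tuple V) (k : 'I_n) (t : R) :
    basis_of <<e>> x ->
  plane e f (t *: \matrix_(i, j) (coord x k (tnth e i) * coord x k (tnth e j))) =
  <<tuple_update x k (tnth x k + t *: tnth (dual_basis e f x) k)>>%VS.
Proof.
move=> bx; set S := \matrix_(_, _) _; set g := dual_basis e f x.
have Ssym : (t *: S)^T = t *: S.
  by apply/matrixP => i j; rewrite !mxE (mulrC (coord _ _ _)).
have xg : symplectic_basis omega x g by exact: symplectic_basis_change.
have sumg i : \sum_j (t *: delta_mx k k : 'M_n) i j *: tnth g j =
    (if i == k then t else 0) *: tnth g k.
  rewrite (bigD1 k) //= big1 ?addr0 => [|j jk]; last first.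
    by rewrite !mxE (negPf jk) andbF mulr0 scale0r.
  by rewrite !mxE eqxx andbT; case: eqP; rewrite ?mulr1 ?mulr0.
(* In the symplectic basis [(x, g)] the right-hand side is also a graph, so both
   sides have dimension [n] and one inclusion suffices. *)
have -> : tuple_update x k (tnth x k + t *: tnth g k) =
    graph_basis x g (t *: delta_mx k k).
  apply/eq_from_tnth => i; rewrite tuple_updateE [RHS]tnth_mktuple.
  by rewrite sumg; case: eqVneq => [->|_]; rewrite ?scale0r ?addr0.
set y := graph_basis _ _ _.
have dimy : \dim <<y>> = n.
  apply: (symplectic_basis_lagrangian (f := g) _).2.
  by apply: symplectic_basis_graph => //; rewrite linearZ /= trmx_delta.
have dimp : \dim (plane e f (t *: S)) = n.
  exact: (symplectic_basis_lagrangian (symplectic_basis_graph ef Ssym)).2.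
apply/eqP; rewrite eqEdim dimy dimp leqnn andbT.
apply/span_subvP => _ /tnthP[i ->]; rewrite tnth_mktuple.
have -> : tnth e i + \sum_j (t *: S) i j *: tnth f j =
    \sum_j coord x j (tnth e i) *: tnth y j.
  under [RHS]eq_bigr do rewrite tnth_mktuple scalerDr.
  rewrite big_split /=; congr (_ + _).
    rewrite [LHS](coord_basis bx) ?memv_span ?mem_tnth //.
    by apply: eq_bigr => j _; rewrite -tnth_nth.
  under [RHS]eq_bigr do rewrite sumg.
  rewrite [RHS](bigD1 k) //= [X in _ = _ + X]big1 ?addr0 => [|j /negPf->]; last first.
    by rewrite scale0r scaler0.
  rewrite eqxx tnth_mktuple !scaler_sumr; apply: eq_bigr => j _.
  by rewrite !mxE !scalerA mulrCA mulrA.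
by apply: memv_suml => j _; rewrite memvZ // memv_span // mem_tnth.
Qed.

End TangentVectors.

(** * The derivative along a line *)

Section Derivative.
Variables (R : realType) (V : vectType R) (n : nat).

Lemma det_dual_neq0 (beta : 'I_n -> {linear V -> R^o}) (x w : n.-tuple V) :
    (forall i j, beta j (tnth x i) = (i == j)%:R) -> basis_of <<x>> w ->
  \det (\matrix_(i, j) (beta j (tnth w i) : R)) != 0.
Proof.
move=> bx bw; apply/det0P => -[v v0 vM].
have wx i : tnth w i \in <<x>>%VS by rewrite (basis_mem bw) // mem_tnth.
have sum0 : \sum_i v 0 i *: w`_i = 0.
  have sx : \sum_i v 0 i *: w`_i \in <<x>>%VS.
    by apply: memv_suml => i _; rewrite memvZ // -tnth_nth.
  rewrite (dual_coord bx sx) big1 // => j _; rewrite linear_sum.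
  rewrite (_ : \sum_i _ = (v *m \matrix_(i, k) (beta k (tnth w i) : R)) 0 j).
    by rewrite vM mxE scale0r.
  by rewrite mxE; apply: eq_bigr => i _; rewrite linearZ -tnth_nth mxE.
have /freeP/(_ _ sum0) v00 := basis_free bw.
by case/eqP: v0; apply/rowP => i; rewrite mxE v00.
Qed.

(** If the planes over the line [t S] have bases [x t] with a common dual family
    [beta] and [Omega (x t) = t a], then [Omega (w L) = det (M t) * t a] at
    the plane [L] of [t S], where [M t] holds the [beta]-coordinates of the frame.  The difference quotient at
    0 is [det (M t) * a], whose limit [det (M 0) * a] vanishes only with [a]. *)
Lemma differential_at_frame (Omega : n.-tuple V -> R)
    (e f : n.-tuple V)
    (w : {vspace V} -> n.-tuple V) (S : 'M[R]_n) (x : R -> n.-tuple V)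
    (beta : 'I_n -> {linear V -> R^o}) (a : R) :
    exterior_form Omega -> smooth_frame e f w -> S^T = S ->
    (forall t, plane e f (t *: S) = <<x t>>%VS) ->
    (forall t i j, beta j (tnth (x t) i) = (i == j)%:R) ->
    (forall t, Omega (x t) = t * a) ->
    differential_at e f (fun L => Omega (w L)) S = 0 -> a = 0.
Proof.
move=> Oe [O [Oo O0 wb ws]] Ssym px bx Ox.
pose M t := \matrix_(i, j) (beta j (tnth (w (plane e f (t *: S))) i) : R).
pose A := (O `&` @sym_mx R n).
have tSsym t : sym_mx (t *: S) by rewrite /sym_mx /= linearZ /= Ssym.
have wx t : O (t *: S) -> basis_of <<x t>> (w (plane e f (t *: S))).
  by move=> Ot; rewrite -px; apply: wb; split.
have OwE t : O (t *: S) -> Omega (w (plane e f (t *: S))) = t * (\det (M t) * a).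
  move=> Ot; rewrite (exterior_form_change (x := x t) (beta := beta)) // => [|y].
    by rewrite Ox mulrCA.
  exact: (basis_mem (wx t Ot)).
have O0S : O (0 *: S) by rewrite scale0r.
have w0 : Omega (w (plane e f 0)) = 0.
  by rewrite -[X in plane _ _ X](scale0r S) (OwE 0) // mul0r.
have scal : (fun t : R => t *: S) @ (0 : R)^' --> (0 : 'M[R]_n).
  apply: cvg_within_filter; have := @scalel_continuous _ _ S 0.
  by rewrite /continuous_at scale0r.
have nearO : \forall t \near (0 : R)^', O (t *: S).
  by apply: scal; apply: open_nbhs_nbhs.
(* The frame is only continuous relative to the symmetric matrices in [O]; the
   line stays among them. *)
have scalA : (fun t : R => t *: S) @ (0 : R)^' --> within A (nbhs (0 : 'M[R]_n)).
  move=> P nP; have nP' : \forall t \near (0 : R)^', A (t *: S) -> P (t *: S).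
    exact: scal nP.
  suff : \forall t \near (0 : R)^', P (t *: S) by [].
  near=> t; have : A (t *: S) -> P (t *: S) by near: t.
  by apply; split => //; near: t.
have Mcvg : (\det (M t) : R^o) @[t --> (0 : R)^'] --> (\det (M 0) : R^o).
  apply: cvg_det => i j.
  have [/subspace_continuousP cont _] := ws i (beta j) 0%N.
  have {}cont := cont 0 (conj O0 (trmx0 _ _ _)).
  rewrite /M !mxE scale0r; under eq_cvg do rewrite mxE.
  exact: (@cvg_comp _ _ _ (fun t => t *: S) _ _ _ _ scalA cont).
rewrite /differential_at /derive => d0.
have lim : (fun h : R => h^-1 *: ((((fun T => Omega (w (plane e f T)) : R^o)
      \o shift 0) (h *: S) - Omega (w (plane e f 0))) : R^o)) @ 0^' -->
    (\det (M 0) * a : R^o).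
  apply: cvg_trans (cvgMr_tmp Mcvg); apply: near_eq_cvg; near=> t.
  rewrite /= addr0 w0 subr0 OwE; last by near: t.
  rewrite /GRing.scale /= mulrA mulVf ?mul1r //.
  by near: t; exact: nbhs_dnbhs_neq.
have : \det (M 0) * a = 0.
  by apply: etrans (esym _) d0; apply: cvg_lim; first exact: norm_hausdorff.
move/eqP; rewrite mulf_eq0 => /orP[|/eqP//].
by rewrite (negPf (det_dual_neq0 (bx 0) (wx 0 O0S))).
Unshelve. all: by end_near.
Qed.

End Derivative.

(** * Characteristic hyperplanes *)

Lemma hyperplane_basis (F : fieldType) (V : vectType F) (H L : {vspace V}) b :
  basis_of H b -> (H <= L)%VS -> (\dim H).+1 = \dim L ->
  exists u, basis_of L (u :: b).
Proof.
move=> bH HL dL; have : ~~ (L <= H)%VS.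
  by apply/negP => /dimvS; rewrite -dL ltnn.
case/subvPn => u uL uH; exists u.
have dH : \dim H = size b.
  by have /eqnP := basis_free bH; rewrite (span_basis bH).
rewrite basisEfree free_cons (span_basis bH) uH (basis_free bH) span_cons.
by rewrite (span_basis bH) subv_add -memvE uL HL /= -dL dH.
Qed.

Theorem theorem3p12 (R : realType) (V : vectType R) (n : nat)
    (omega : {skew_symmetric V}) (Omega : n.-tuple V -> R) (L H : {vspace V})
    (hV : \dim {:V} = (2 * n)%N)
    (homega : nondegenerate omega)
    (hOmega : exterior_form Omega)
    (hL : E_ omega Omega L)
    (hHL : (H <= L)%VS)
    (hH : (\dim H).+1 = \dim L)
    (hchar : characteristic omega Omega L H) :
  strongly_characteristic n omega (E_ omega Omega) H.
Proof.
have [isoH _ [e [f [w [ef eL sw dF]]]]] := hchar.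
have [[isoL dimL] OmL] := hL.
split=> // L' [[isoL' dimL'] HL']; split=> //.
case: n => [|m] in Omega hV hOmega hL dimL OmL e f w ef eL sw dF isoL' dimL' hchar *.
  by rewrite dimL in hH.
have [b bH] : exists b : m.-tuple V, basis_of H b.
  have -> : m = \dim H by apply: succn_inj; rewrite hH dimL.
  by exists (vbasis H); exact: vbasisP.
have [u bL] := hyperplane_basis bH hHL hH.
have hH' : (\dim H).+1 = \dim L' by rewrite hH dimL dimL'.
have [u' bL'] := hyperplane_basis bH HL' hH'.
pose x := [tuple of u :: b]; have bx : basis_of <<e>> x by rewrite eL.
have xg := symplectic_basis_change ef bx; set g := dual_basis e f x in xg.
pose xt y := tuple_update x ord0 y.
have xtE y : xt y = y :: b :> seq V.
  suff -> : xt y = [tuple of y :: b] by [].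
  apply/eq_from_tnth => i; rewrite tuple_updateE; case: eqVneq => [->|i0].
    by rewrite tnth0.
  by case: (unliftP ord0 i) i0 => [j|] ->; rewrite ?eqxx // !tnthS.
have Hxt y : (H <= <<xt y>>)%VS.
  by rewrite xtE span_cons (span_basis bH) addvSr.
have xtL y : y \in L -> Omega (xt y) = 0.
  move=> yL; apply: OmL => z; rewrite memtE xtE inE => /predU1P[->//|zb].
  by apply: (subvP hHL); exact: basis_mem zb.
have xL k : tnth x k \in L by rewrite (basis_mem bL) // mem_tnth.
(* The vector [v] transverse to [L] is [tnth g ord0], dual to [u]. *)
have Ov0 : Omega (xt (tnth g ord0)) = 0.
  pose S : 'M[R]_m.+1 :=
    \matrix_(i, j) (coord x ord0 (tnth e i) * coord x ord0 (tnth e j)).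
  have Ssym : S^T = S by apply/matrixP => i j; rewrite !mxE mulrC.
  have planeE t := plane_rank1 ef ord0 t bx.
  have := (differential_at_frame (x := fun t => xt (tnth x ord0 + t *: tnth g ord0))
    (beta := fun j => pairing omega (tnth g j)) hOmega sw Ssym planeE); apply.
  - move=> t i j; have xgE := symplectic_basis_dual xg.
    rewrite tuple_updateE; case: eqVneq => [->|_]; last exact: xgE.
    rewrite linearD linearZ /= xgE /pairing; have [_ -> _] := xg ord0 j.
    by rewrite scaler0 addr0.
  - by move=> t; rewrite addrC hOmega.1 -!/(xt _) (xtL _ (xL ord0)) addr0.
  - apply: dF; apply: tangent_prolongation_line => // t.
    by rewrite planeE.
(* The multiple of [v] is chosen to make the difference orthogonal to [u]; it is
   orthogonal to [H] because [u'] and [v] are. *)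
have [c u'E] : exists c, u' - c *: tnth g ord0 \in L.
  exists (omega u u'); rewrite -(span_basis bL).
  apply: (symplectic_basis_orthogonal (e := x) xg hV) => k.
  rewrite omegaDr omegaNr omegaZr; have [_ _ ->] := xg k ord0.
  case: (unliftP ord0 k) => [j ->|->]; last by rewrite tnth0 eqxx mulr1 subrr.
  rewrite eq_sym (negPf (neq_lift _ _)) mulr0 subr0 tnthS.
  apply: (orthovP isoL'); last by rewrite (basis_mem bL') ?mem_head.
  by apply: (subvP HL'); rewrite (basis_mem bH) // mem_tnth.
rewrite -(span_basis bL') -xtE.
apply: exterior_form_span_eq0 => //.
rewrite -[u'](subrK (c *: tnth g ord0)) addrC /xt hOmega.1.
by rewrite -!/(xt _) Ov0 xtL // mulr0 addr0.
Qed.
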